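(* Let $\mathcal X$ be a Hilbert space and let $V\in\mathcal C^0(0,T;\mathcal X)$ be such that $V_{|I_n}\in\mathbb P_{p_n^t}(I_n;\mathcal X)$ for all $n=1,\dots,N$, with a given element $(V^-)'(0,\cdot)\in\mathcal X$, and let $\widehat V$ be its reconstruction (defined in the context). Then, for all $n=1,\dots,N$, $$\|(V-\widehat V)'\|_{L^2(I_n;\mathcal X)}^2=\tau_n\,c_1(p_n^t)^2\,\|[\![V']\!](t_{n-1},\cdot)\|_{\mathcal X}^2,$$ $$\|(V-\widehat V)'\|_{L^\infty(I_n;\mathcal X)}^2=\|[\![V']\!](t_{n-1},\cdot)\|_{\mathcal X}^2,$$ $$\|V-\widehat V\|_{L^2(I_n;\mathcal X)}^2\le\tau_n^3\,c_2(p_n^t)^2\,\|[\![V']\!](t_{n-1},\cdot)\|_{\mathcal X}^2,$$ where $$c_1(p_n^t)^2:=\frac{p_n^t}{(2p_n^t-1)(2p_n^t+1)},\qquad c_2(p_n^t)^2:=\begin{cases}\dfrac14\dfrac{p_n^t}{(p_n^t-2)(p_n^t-1)(2p_n^t-1)(2p_n^t+1)}&\text{if }p_n^t\ge3,\\[2mm]\dfrac{2}{15\pi^2}&\text{if }p_n^t=2,\end{cases}$$ so that $c_1(p_n^t)\approx(p_n^t)^{-1/2}$ and $c_2(p_n^t)\approx(p_n^t)^{-3/2}$.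
   Context: Time grid: $0=t_0<t_1<\dots<t_N=T$, $I_n:=(t_{n-1},t_n]$, $\tau_n:=t_n-t_{n-1}$, with polynomial degrees $p_n^t\ge2$. $\mathbb P_q(I_n;\mathcal X)$ is the space of $\mathcal X$-valued polynomials in time of degree at most $q$ on $I_n$; primes are time derivatives. For $n\ge2$, $(V^-)'(t_{n-1},\cdot):=V'{}_{|I_{n-1}}(t_{n-1},\cdot)$; $(V^+)'(t_{n-1},\cdot):=V'{}_{|I_n}(t_{n-1},\cdot)$; $[\![V']\!](t_{n-1},\cdot):=(V^+)'(t_{n-1},\cdot)-(V^-)'(t_{n-1},\cdot)$ for $n=1,\dots,N$ (for $n=1$ with the given element $(V^-)'(0,\cdot)$). Reconstruction: $\widehat V$ is defined piecewise; for each $n$, $\widehat V_{|I_n}\in\mathbb P_{p_n^t+1}(I_n;\mathcal X)$ satisfies $$(\widehat V'',q)_{L^2(I_n;\mathcal X)}=(V'',q)_{L^2(I_n;\mathcal X)}+([\![V']\!](t_{n-1},\cdot),q(t_{n-1},\cdot))_{\mathcal X}\quad\forall q\in\mathbb P_{p_n^t-1}(I_n;\mathcal X),$$ $$\widehat V(t_{n-1},\cdot)=V(t_{n-1},\cdot),\qquad\widehat V'(t_{n-1},\cdot)=(V^-)'(t_{n-1},\cdot)\quad\text{in }\mathcal X,$$ where the point values of $\widehat V$ and $\widehat V'$ at $t_{n-1}$ are those of the polynomial on $I_n$. $A\approx B$ means two-sided bounds with positive constants independent of $p_n^t$. *)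

(* Defs.v *)
From HB Require Import structures.
From mathcomp Require Import all_boot all_order all_algebra.
From mathcomp Require Import sesquilinear.
From mathcomp Require Import all_classical all_reals all_analysis.

Set Implicit Arguments.
Unset Strict Implicit.
Unset Printing Implicit Defensive.

Import Order.TTheory GRing.Theory Num.Theory.
Import numFieldNormedType.Exports.

Local Open Scope classical_set_scope.
Local Open Scope ring_scope.

Section TimeGrid.
Context {R : realType}.

Definition time_grid (N : nat) (T : R) (t : nat -> R) : Prop :=
  [/\ (0 < N)%N, t 0%N = 0, t N = T
    & forall n, (n < N)%N -> t n < t n.+1].

(* Intervals are numbered from 1: the n-th one is ]t (n - 1), t n]. *)
Definition time_itv (t : nat -> R) (n : nat) : set R := `]t n.-1, t n].

Definition time_step (t : nat -> R) (n : nat) : R := t n - t n.-1.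

End TimeGrid.

Section TimePolynomials.
Context {R : realType} {X : normedModType R}.

Definition time_poly (q : nat) : set (R -> X) :=
  [set P | exists a : nat -> X, forall s, P s = \sum_(k < q.+1) s ^+ k *: a k].

Definition poly_on (q : nat) (I : set R) (f : R -> X) : Prop :=
  exists2 P, time_poly q P & forall s, I s -> f s = P s.

(* The restriction of f to I, seen as a polynomial on the whole line: it is
   uniquely determined when I is a nondegenerate interval and poly_on q I f.
   Values at the left endpoint of I, which does not belong to I, and one-sided
   derivatives at the endpoints of I are those of this polynomial. *)
Definition restr_poly (q : nat) (I : set R) (f : R -> X) : R -> X :=
  get [set P | time_poly q P /\ forall s, I s -> f s = P s].

End TimePolynomials.

Section Bochner.
Context {R : realType} {X : normedModType R}.

Definition hilbert_norm (ip : {dot X for idfun}) : Prop :=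
  forall x : X, `|x| ^+ 2 = ip x x.

Definition L2_inner (ip : {dot X for idfun}) (I : set R) (f g : R -> X) : R :=
  (\int[lebesgue_measure]_(s in I) ip (f s) (g s)).

Definition Lp_norm (r : \bar R) (I : set R) (f : R -> X) : \bar R :=
  'N[lebesgue_measure]_r [ (fun s => (`|f s|)%:E) \_ I ]%E.

End Bochner.

Section Reconstruction.
Context {R : realType} {X : normedModType R}.
Variables (t : nat -> R) (p : nat -> nat) (V : R -> X) (v0 : X).

(* Traces at t (n - 1), for n >= 1; v0 is the given value at time 0. *)
Definition dV_plus (n : nat) : X :=
  derive1 (restr_poly (p n) (time_itv t n) V) (t n.-1).

Definition dV_minus (n : nat) : X :=
  if n == 1%N then v0
  else derive1 (restr_poly (p n.-1) (time_itv t n.-1) V) (t n.-1).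

Definition jump_dV (n : nat) : X := dV_plus n - dV_minus n.

(* Inside integrals the two-sided derivatives of V and W are used: on the
   n-th interval they may differ from those of the polynomial only at t n. *)
Definition reconstruction_on (ip : {dot X for idfun}) (n : nat)
    (W : R -> X) : Prop :=
  let I := time_itv t n in
  let WI := restr_poly (p n).+1 I W in
  [/\ poly_on (p n).+1 I W,
      forall q, time_poly (p n).-1 q ->
        L2_inner ip I (derive1n 2 W) q
        = L2_inner ip I (derive1n 2 V) q + ip (jump_dV n) (q (t n.-1)),
      WI (t n.-1) = V (t n.-1)
    & derive1 WI (t n.-1) = dV_minus n].

End Reconstruction.

Section Constants.
Context {R : realType}.

Definition c1 (p : nat) : R :=
  Num.sqrt (p%:R / ((2 * p%:R - 1) * (2 * p%:R + 1))).

Definition c2 (p : nat) : R :=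
  Num.sqrt (if p == 2%N then 2 / (15 * pi ^+ 2)
            else 1 / 4 * (p%:R / ((p%:R - 2) * (p%:R - 1) *
                                  (2 * p%:R - 1) * (2 * p%:R + 1)))).

(* Equivalence uniform in the degree, which is at least 2. *)
Definition deg_equiv (A B : nat -> R) : Prop :=
  exists c C : R, [/\ 0 < c, 0 < C
    & forall p, (2 <= p)%N -> c * B p <= A p <= C * B p].

End Constants.

(* Main.v *)
Require Import Defs.
From HB Require Import structures.
From mathcomp Require Import all_boot all_order all_algebra.
From mathcomp Require Import sesquilinear.
From mathcomp Require Import all_classical all_reals all_analysis.
From mathcomp Require Import measurable_realfun ess_sup_inf.
From mathcomp Require Import ring lra.

(** On one interval I = ]a, b] with degree p = k + 2, the error e = V - Vhat is
    a fixed scalar polynomial times the jump J = V'(a+) - V'(a-), so all three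
    norms reduce to norms of that scalar polynomial.

    The two point conditions give e(a) = 0 (this uses the continuity of V at a)
    and e'(a) = J, and the variational condition says that
    (e'', q) = - (J, q(a)) for all q of degree less than p. Pairing with
    constant directions y turns this into a real problem for each polynomial
    <e, y>: it has at most one solution, because the second derivative of the
    difference of two solutions has degree less than p, hence may be used as its
    own test function and vanishes. On the reference interval [-1, 1] a solution
    with unit slope at the left end has derivative (-1)^p (L_p - L_(p-1)) / 2,
    a Radau polynomial, where L_n is the Legendre polynomial: it equals 1 at
    -1, vanishes at 1 and is orthogonal to the degrees up to p - 2, so one
    integration by parts gives the variational condition
    ([profile_second_deriv], [profile_unique], [error_eq_profile]).

    The first norm then follows from the orthogonality and the norms of the L_n
    ([profile_deriv_norm]); the second from |L_n| <= 1 on [-1, 1]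
    ([legendre_le1]) and the value 1 at the left end. For the third, integrating
    (2n + 1) L_n = L_(n+1)' - L_(n-1)' expresses the profile itself by Legendre
    polynomials, and its squared norm is exactly
    tau^3 p / (2 (2p-3) (2p-1) (2p+1) (2p+3)) ([profile_norm]). This is at most
    tau^3 c_2(p)^2: for p >= 3 because 2 (p-2) (p-1) <= (2p-3) (2p+3), and for
    p = 2 because 1/105 <= 2 / (15 pi^2), that is, pi^2 <= 14. *)

Set Implicit Arguments.
Unset Strict Implicit.
Unset Printing Implicit Defensive.

Import Order.TTheory GRing.Theory Num.Theory.
Import numFieldNormedType.Exports.

Local Open Scope classical_set_scope.
Local Open Scope ring_scope.

(** * Integration of polynomials *)

Section PolynomialIntegral.
Context {R : realType}.
Implicit Types (p q : {poly R}) (a b c x y : R).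

Lemma deriv_natr n : (n%:R : {poly R})^`() = 0.
Proof. by rewrite -polyC_natr derivC. Qed.

Lemma horner_natr n x : (n%:R : {poly R}).[x] = n%:R.
Proof. by rewrite -polyC_natr hornerC. Qed.

Lemma size_deriv_le p n : (size p <= n.+1)%N -> (size p^`() <= n)%N.
Proof.
have [->|p0] := eqVneq p 0; first by rewrite deriv0 size_poly0.
by move=> sp; rewrite -ltnS (leq_trans (lt_size_deriv p0)).
Qed.

(** The coefficient of degree 0 is [p`_0 / 0], which is 0. *)
Definition antideriv p : {poly R} :=
  \poly_(i < (size p).+1) (p`_i.-1 / i%:R).

Lemma coef_antideriv p i : (antideriv p)`_i = p`_i.-1 / i%:R.
Proof.
rewrite coef_poly; case: ltnP => // pi.
by rewrite nth_default ?mul0r//; case: i pi.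
Qed.

Lemma deriv_antideriv p : (antideriv p)^`() = p.
Proof.
apply/polyP => i.
by rewrite coef_deriv coef_antideriv/= -[LHS]mulr_natr divfK ?pnatr_eq0.
Qed.

Lemma deriv_eq0_horner p x y : p^`() = 0 -> p.[x] = p.[y].
Proof.
move=> dp0; suff /size1_polyC -> : (size p <= 1)%N by rewrite !hornerC.
apply/leq_sizeP => -[//|i] _.
move/polyP/(_ i)/eqP : dp0.
by rewrite coef_deriv coef0 mulrn_eq0/= => /eqP.
Qed.

(** The integral of a polynomial over [a, b], defined through its primitive so
    that linearity and integration by parts are algebraic identities, free of
    integrability conditions. *)
Definition pint a b p : R := (antideriv p).[b] - (antideriv p).[a].

Lemma pint_deriv a b p : pint a b p^`() = p.[b] - p.[a].
Proof.
have := @deriv_eq0_horner (antideriv p^`() - p) b a.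
rewrite derivB deriv_antideriv subrr !hornerE => /(_ erefl) e.
by rewrite /pint; lra.
Qed.

Lemma pintD a b p q : pint a b (p + q) = pint a b p + pint a b q.
Proof.
rewrite -[in LHS](deriv_antideriv p) -[in LHS](deriv_antideriv q) -derivD.
by rewrite pint_deriv !hornerD /pint; ring.
Qed.

Lemma pintZ a b c p : pint a b (c *: p) = c * pint a b p.
Proof.
rewrite -[in LHS](deriv_antideriv p) -derivZ.
by rewrite pint_deriv !hornerZ /pint; ring.
Qed.

Lemma pint_natrM a b n p : pint a b (n%:R * p) = n%:R * pint a b p.
Proof. by rewrite -polyC_natr mul_polyC pintZ. Qed.

Lemma pintN a b p : pint a b (- p) = - pint a b p.
Proof. by rewrite -scaleN1r pintZ mulN1r. Qed.

Lemma pintB a b p q : pint a b (p - q) = pint a b p - pint a b q.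
Proof. by rewrite pintD pintN. Qed.

Lemma pint_parts a b p q :
  pint a b (p^`() * q) = (p * q).[b] - (p * q).[a] - pint a b (p * q^`()).
Proof. by rewrite -pint_deriv derivM pintD addrK. Qed.

Lemma pint_comp_affine a b c d p :
  c * pint a b (p \Po (c *: 'X + d%:P)) = pint (c * a + d) (c * b + d) p.
Proof.
have -> : c * pint a b (p \Po (c *: 'X + d%:P)) =
    pint a b (antideriv p \Po (c *: 'X + d%:P))^`().
  rewrite deriv_comp deriv_antideriv !poly.derivE/= addr0 alg_polyC [_ * c%:P]mulrC.
  by rewrite mul_polyC pintZ.
by rewrite pint_deriv !horner_comp !hornerE.
Qed.

Lemma pint_sqrB a b p q : pint a b ((p - q) * (p - q)) =
  pint a b (p * p) - 2 * pint a b (p * q) + pint a b (q * q).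
Proof.
by rewrite -pint_natrM -pintB -pintD; congr pint; ring.
Qed.

Lemma pint_mulZZ a b (c d : R) p q :
  pint a b (c *: p * (d *: q)) = c * d * pint a b (p * q).
Proof. by rewrite -scalerAl -scalerAr !pintZ mulrA. Qed.

Lemma le_horner p a b : a <= b ->
  (forall x, a < x < b -> 0 <= p^`().[x]) -> p.[a] <= p.[b].
Proof.
move=> ab p'0.
apply: (@ger0_derive1_le_cc _ (horner p) a b) => //; rewrite ?in_itv/= ?lexx ?ab//.
- by move=> x; rewrite in_itv/= -derive.derivE; exact: p'0.
- exact/continuous_subspaceT/continuous_horner.
Qed.

Lemma poly_itv_eq0 p a b : a < b ->
  (forall x, a < x < b -> p.[x] = 0) -> p = 0.
Proof.
move=> ab p0; pose n := size p.
(* size p distinct points inside ]a, b[, more than the degree of p *)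
pose r i : R := a + (b - a) * (i.+1%:R / n.+1%:R).
have ba : 0 < b - a by rewrite subr_gt0.
apply: (@roots_geq_poly_eq0 _ p [seq r i | i <- iota 0 n]).
- apply/allP => x /mapP[i]; rewrite mem_iota/= add0n => il ->{x}.
  apply/rootP/p0; rewrite /r ltrDl mulr_gt0 ?divr_gt0 ?ltr0n//=.
  by rewrite -ltrBrDl gtr_pMr// ltr_pdivrMr ?ltr0n// mul1r ltr_nat.
- rewrite map_inj_uniq ?iota_uniq// => i j /addrI/(mulfI (lt0r_neq0 ba)).
  move/(mulIf _); rewrite invr_eq0 pnatr_eq0 => /(_ isT)/eqP.
  by rewrite eqr_nat => /eqP[].
- by rewrite size_map size_iota.
Qed.

(** The primitive of a square is nondecreasing, so it is constant on [a, b] as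
    soon as it takes the same value at both ends. *)
Lemma pint_sqr_eq0 q a b : a < b -> pint a b (q * q) = 0 -> q = 0.
Proof.
move=> ab I0; suff : q * q = 0 by move/eqP; rewrite mulf_eq0 orbb => /eqP.
rewrite -[LHS]deriv_antideriv; set F := antideriv _.
suff -> : F = (F.[a])%:P by rewrite derivC.
apply/eqP; rewrite -subr_eq0; apply/eqP/(@poly_itv_eq0 _ a b ab) => x /andP[ax xb].
have F' y : 0 <= F^`().[y] by rewrite deriv_antideriv hornerM -expr2 sqr_ge0.
have := @le_horner F a x (ltW ax) (fun y _ => F' y).
have := @le_horner F x b (ltW xb) (fun y _ => F' y).
move: I0; rewrite /pint -/F !hornerE; lra.
Qed.

End PolynomialIntegral.

(** * Legendre polynomials *)

Section Legendre.
Context {R : realType}.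
Implicit Types (p q : {poly R}) (n : nat) (x : R).

Fixpoint legendre n : {poly R} :=
  if n is n1.+1 then
    if n1 is n2.+1 then
      (n%:R^-1)%:P * ((n2%:R * 2 + 3) * 'X * legendre n1 - n1%:R * legendre n2)
    else 'X
  else 1.

Notation L := legendre.

Lemma legendreSS n : L n.+2 =
  (n.+2%:R^-1)%:P * ((n%:R * 2 + 3) * 'X * L n.+1 - n.+1%:R * L n).
Proof. by []. Qed.

Lemma legendre_rec n :
  (n%:R + 2) * L n.+2 = (2 * n%:R + 3) * 'X * L n.+1 - (n%:R + 1) * L n.
Proof.
have e : (n%:R + 2) * (n.+2%:R^-1)%:P = 1 :> {poly R}.
  rewrite -natrD addn2 -polyC_natr -polyCM divff ?pnatr_eq0//.
by rewrite legendreSS mulrA e mul1r -natr1; ring.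
Qed.

Lemma size_legendre n : (size (L n) <= n.+1)%N.
Proof.
elim/ltn_ind: n => -[|[|n]] IH; [by rewrite size_poly1|by rewrite size_polyX|].
rewrite legendreSS -!polyC_natr -polyCM -polyCD -mulrA !mul_polyC.
rewrite (leq_trans (size_scale_leq _ _))// (leq_trans (size_polyD _ _))//.
rewrite geq_max size_polyN !(leq_trans (size_scale_leq _ _))//.
- by apply: leq_trans (IH n _) _; rewrite // ltnS leqW.
- by rewrite mulrC (leq_trans (size_polyMleq _ _))// size_polyX addn2 ltnS IH.
Qed.

(** The two mixed relations between consecutive Legendre polynomials and their
    derivatives must be proved together: the derivative of the three-term
    recurrence and the second relation give the next instance of the first, and
    both relations, with the recurrence, give the next instance of the second.
    The primitives and the differential equation below follow from them. *)
Lemma legendre_deriv n :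
  (L n.+1)^`() = 'X * (L n)^`() + (n%:R + 1) * L n /\
  'X * (L n.+1)^`() - (L n)^`() = (n%:R + 1) * L n.+1.
Proof.
elim: n => [|n [IA IB]].
  by rewrite /= !poly.derivE; split; ring.
have n2 : (n%:R + 2 : {poly R}) != 0.
  by rewrite -natrD addn2 -polyC_natr polyC_eq0 pnatr_eq0.
have rec := legendre_rec n.
have drec : (n%:R + 2) * (L n.+2)^`() = (2 * n%:R + 3) * L n.+1 +
    (2 * n%:R + 3) * 'X * (L n.+1)^`() - (n%:R + 1) * (L n)^`().
  move: rec {IA IB}; move: (L n.+2) (L n.+1) (L n) => w v u.
  move/(congr1 (@deriv R)).
  rewrite !(derivM, derivB, derivD, deriv_natr, derivX, derivC) => rec.
  transitivity ((0 + 0) * w + (n%:R + 2) * w^`()); first by ring.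
  by rewrite rec; ring.
have dL : (L n.+2)^`() = 'X * (L n.+1)^`() + (n.+1%:R + 1) * L n.+1.
  apply: (mulfI n2); rewrite drec.
  have -> : (L n)^`() = 'X * (L n.+1)^`() - (n%:R + 1) * L n.+1.
    by rewrite -IB; ring.
  by rewrite -natr1; ring.
split=> //; rewrite dL -natr1.
have IA' : 'X * (L n)^`() = (L n.+1)^`() - (n%:R + 1) * L n by rewrite IA; ring.
have IB' : 'X * (L n.+1)^`() = (L n)^`() + (n%:R + 1) * L n.+1 by rewrite -IB; ring.
rewrite [in LHS]mulrDr IB' mulrDr IA'.
transitivity ((n%:R + 2) * L n.+2); first by rewrite rec; ring.
by ring.
Qed.

Lemma legendre_deriv_diff n :
  (L n.+2)^`() - (L n)^`() = (2 * n%:R + 3) * L n.+1.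
Proof.
have [_ B] := legendre_deriv n; have [A _] := legendre_deriv n.+1.
have -> : (L n)^`() = 'X * (L n.+1)^`() - (n%:R + 1) * L n.+1.
  by rewrite -B; ring.
by rewrite A -natr1; ring.
Qed.

Lemma legendre_deriv_weighted n :
  (1 - 'X * 'X) * (L n.+1)^`() = (n%:R + 1) * (L n - 'X * L n.+1).
Proof.
have [A B] := legendre_deriv n.
have B' : 'X * (L n.+1)^`() = (L n)^`() + (n%:R + 1) * L n.+1.
  by rewrite -B; ring.
rewrite mulrBl mul1r -mulrA B' mulrDr {1}A; ring.
Qed.

(** The Sturm-Liouville equation. *)
Lemma legendre_ode n : ((1 - 'X * 'X) * (L n)^`())^`() =
  - (n%:R * (n%:R + 1)) * L n.
Proof.
case: n => [|n]; first by rewrite /= derivC mulr0 deriv0 mul0r oppr0 mul0r.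
have [_ B] := legendre_deriv n.
rewrite legendre_deriv_weighted.
have -> : ((n%:R + 1) * (L n - 'X * L n.+1))^`() =
   (n%:R + 1) * ((L n)^`() - L n.+1 - 'X * (L n.+1)^`()).
  move: (L n.+1) (L n) => w v.
  rewrite !(derivM, derivB, derivD, deriv_natr, derivX, derivC, derivN); ring.
have -> : (L n)^`() = 'X * (L n.+1)^`() - (n%:R + 1) * L n.+1.
  by rewrite -B; ring.
by rewrite -natr1; ring.
Qed.

Lemma legendre_horner_rec n x :
  (n%:R + 2) * (L n.+2).[x] =
  (2 * n%:R + 3) * x * (L n.+1).[x] - (n%:R + 1) * (L n).[x].
Proof.
have := congr1 (horner^~ x) (legendre_rec n).
by rewrite !(hornerM, hornerD, hornerN, hornerX, horner_natr, hornerC).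
Qed.

Lemma legendre_at1 n : (L n).[1] = 1.
Proof.
suff [] : (L n).[1] = 1 /\ (L n.+1).[1] = 1 by [].
elim: n => [|n [IH1 IH2]]; first by rewrite /= !hornerE.
split=> //; have n2 : n%:R + 2 != 0 :> R by rewrite -natrD addn2 pnatr_eq0.
by apply: (mulfI n2); rewrite legendre_horner_rec IH1 IH2; ring.
Qed.

Lemma legendre_atN1 n : (L n).[-1] = (-1) ^+ n.
Proof.
suff [] : (L n).[-1] = (-1) ^+ n /\ (L n.+1).[-1] = (-1) ^+ n.+1 by [].
elim: n => [|n [IH1 IH2]]; first by rewrite /= !hornerE.
split=> //; have n2 : n%:R + 2 != 0 :> R by rewrite -natrD addn2 pnatr_eq0.
by apply: (mulfI n2); rewrite legendre_horner_rec IH1 IH2 !exprS; ring.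
Qed.

Notation int1 := (pint (-1) 1).

(** By [legendre_deriv_diff], L_n is up to a factor the derivative of
    L_(n+1) - L_(n-1), which vanishes at both ends; integrating by parts trades
    one degree of [q] for one index, so the induction is on the size of [q],
    with the index free. *)
Lemma legendre_ortho n q : (size q <= n)%N -> int1 (L n * q) = 0.
Proof.
suff : forall k m, (k <= m)%N -> forall q, (size q <= k)%N -> int1 (L m * q) = 0.
  by move=> /(_ n n (leqnn n)); apply.
elim=> [|k IH] m km {}q sq.
  move: sq; rewrite leqn0 size_poly_eq0 => /eqP->.
  by rewrite mulr0 -deriv0 pint_deriv !horner0 subrr.
case: m km => [//|m] km.
have m3 : (2 * m + 3)%:R != 0 :> R by rewrite pnatr_eq0 addn3.
apply: (mulfI m3); rewrite -pint_natrM mulrA natrD natrM -legendre_deriv_diff.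
rewrite mulr0 -derivB pint_parts.
have sq' := size_deriv_le sq.
rewrite [_ * q^`()]mulrBl pintB !IH ?(leq_trans km) ?leqW//.
rewrite !hornerM !hornerD !hornerN !legendre_at1 !legendre_atN1 !exprS.
by ring.
Qed.

(** Integrating (x L_n^2)' gives the sum of the squared norm and of twice the
    integral of L_n x L_n'; in the latter x L_n' is n L_n plus a derivative of
    lower degree, orthogonal to L_n. *)
Lemma legendre_norm_scaled n : (2 * n%:R + 1) * int1 (L n * L n) = 2.
Proof.
have parts p : int1 (p * p) + 2 * int1 (p * ('X * p^`())) =
    p.[1] * p.[1] + p.[-1] * p.[-1].
  have -> : 2 * int1 (p * ('X * p^`())) = int1 (2%:R * (p * ('X * p^`()))).
    by rewrite pint_natrM.
  rewrite -pintD.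
  have -> : p * p + 2 * (p * ('X * p^`())) = ('X * p * p)^`().
    by rewrite !(derivM, derivX); ring.
  by rewrite pint_deriv !hornerE; ring.
have := parts (L n); rewrite legendre_at1 legendre_atN1 -[(-1) ^+ n * _]expr2 sqrr_sign.
case: n => [|n]; first by rewrite derivC !mulr0 -[in 2 * _]deriv0 pint_deriv !horner0; lra.
have [_ B] := legendre_deriv n.
have -> : 'X * (L n.+1)^`() = (L n)^`() + n.+1%:R * L n.+1.
  by rewrite -natr1 -B; ring.
rewrite [L n.+1 * (_ + _)]mulrDr pintD (@legendre_ortho n.+1 (L n)^`()) ?add0r; last first.
  by rewrite leqW// size_deriv_le// size_legendre.
by rewrite mulrCA pint_natrM; lra.
Qed.

Lemma legendre_norm n : int1 (L n * L n) = 2 / (2 * n%:R + 1).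
Proof.
have n0 : 2 * n%:R + 1 != 0 :> R by rewrite -natrM natr1 pnatr_eq0.
by apply: (mulfI n0); rewrite legendre_norm_scaled mulrC divfK.
Qed.

Lemma legendre_orthogonal i j : i != j -> int1 (L i * L j) = 0.
Proof.
by rewrite neq_ltn => /orP[ij|ij]; [rewrite mulrC|];
  rewrite legendre_ortho// (leq_trans (size_legendre _)).
Qed.

(** With c = n (n + 1), the function F = c L_n^2 + (1 - x^2) L_n'^2 dominates
    c L_n^2 on [-1, 1], and the Sturm-Liouville equation gives
    F' = 2 x L_n'^2. Hence F decreases on [-1, 0] and increases on [0, 1], and
    it is bounded by its value c at both ends. *)
Lemma legendre_le1 n x : -1 <= x <= 1 -> `|(legendre n).[x]| <= 1.
Proof.
case: n => [|n]; first by rewrite hornerC normr1.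
move=> /andP[x1 x2]; set p := legendre _; pose c : R := n.+1%:R * n.+2%:R.
pose W := (1 - 'X * 'X) * p^`().
pose F := c%:P * (p * p) + W * p^`().
have W' : W^`() = - c%:P * p.
  by rewrite legendre_ode /c polyCM !polyC_natr natr1.
have F' : F^`() = 2 * 'X * (p^`() * p^`()).
  have dF (w q : {poly R}) : (c%:P * (q * q) + w * q^`())^`() =
      c%:P * 2 * q * q^`() + w^`() * q^`() + w * q^`()^`().
    by rewrite !(derivM, derivD, derivC); ring.
  have dW (q : {poly R}) : ((1 - 'X * 'X) * q)^`() =
      - 2 * 'X * q + (1 - 'X * 'X) * q^`().
    by rewrite !(derivM, derivB, derivX, derivC); ring.
  have W'' : (1 - 'X * 'X) * p^`()^`() = - c%:P * p + 2 * 'X * p^`().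
    by rewrite -W' dW; ring.
  have WE : W * p^`()^`() = p^`() * (- c%:P * p + 2 * 'X * p^`()).
    by rewrite -W'' /W; ring.
  by rewrite dF W' WE; ring.
have FE y : F.[y] = c * (p.[y] * p.[y]) + (1 - y * y) * (p^`().[y] * p^`().[y]).
  by rewrite !(hornerM, hornerD, hornerN, hornerC, hornerX) -?mulrA.
have F1 : F.[1] = c by rewrite FE legendre_at1; ring.
have FN1 : F.[-1] = c.
  by rewrite FE legendre_atN1 -[(-1) ^+ _ * _]expr2 sqrr_sign; ring.
have Fx : F.[x] <= c.
  have [x0|x0] := lerP 0 x.
    rewrite -F1; apply: le_horner => // y /andP[xy _].
    rewrite F' !hornerM hornerX mulr_ge0 -?expr2 ?sqr_ge0// mulr_ge0//.
      by rewrite horner_natr.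
    by rewrite (le_trans x0)// ltW.
  rewrite -FN1 -lerN2 -!hornerN; apply: le_horner => // y /andP[_ yx].
  rewrite derivN F' hornerN !hornerM hornerX -mulNr mulr_ge0 -?expr2 ?sqr_ge0//.
  by rewrite -mulrN mulr_ge0 ?horner_natr// oppr_ge0 ltW// (lt_trans yx).
have c0 : 0 < c by rewrite mulr_gt0.
rewrite -(@ler_pXn2r _ 2)// ?nnegrE// expr1n real_normK ?num_real//.
rewrite -(ler_pM2l c0) mulr1 (le_trans _ Fx)//.
rewrite FE -expr2 lerDl mulr_ge0 -?expr2 ?sqr_ge0//.
by rewrite subr_ge0 expr2; nra.
Qed.

End Legendre.

(** * The error profile on the reference interval and on [a, b] *)

Section Radau.
Context {R : realType}.
Implicit Types (p q : {poly R}) (k n : nat) (a b x y : R).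
Notation L := (@legendre R).
Notation int1 := (@pint R (-1) 1).

Lemma double_add_neq0 n m : 2 * n%:R + m.+1%:R != 0 :> R.
Proof. by rewrite -natrM -natrD pnatr_eq0 addnS. Qed.

(** The polynomial of degree [k + 2] on [-1, 1] that is orthogonal to the
    degrees up to [k], equals 1 at [-1] and 0 at [1]. It is the derivative of
    the error for the degree p = [k + 2]; this shift encodes p >= 2. *)
Definition radau k : {poly R} := ((-1) ^+ k / 2) *: (L k.+2 - L k.+1).

(** The primitive of [radau k] that vanishes at [-1], obtained by integrating
    each Legendre polynomial with [legendre_deriv_diff]. *)
Definition radau_prim k : {poly R} := ((-1) ^+ k / 2) *:
  ((2 * k%:R + 5)^-1 *: (L k.+3 - L k.+1) - (2 * k%:R + 3)^-1 *: (L k.+2 - L k)).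

Lemma radau_prim_deriv k : (radau_prim k)^`() = radau k.
Proof.
have k5 : 2 * k%:R + 5 != 0 :> R by exact: (double_add_neq0 k 4).
have k3 : 2 * k%:R + 3 != 0 :> R by exact: (double_add_neq0 k 2).
rewrite derivZ; congr (_ *: _); rewrite derivB !derivZ !derivB.
rewrite !legendre_deriv_diff.
have -> : 2 * k.+1%:R + 3 = (2 * k%:R + 5)%:P :> {poly R}.
  by rewrite -natr1 polyCD polyCM !polyC_natr; ring.
have -> : 2 * k%:R + 3 = (2 * k%:R + 3)%:P :> {poly R}.
  by rewrite polyCD polyCM !polyC_natr.
by rewrite !mul_polyC !scalerA !mulVf// !scale1r.
Qed.

Lemma radau_primN1 k : (radau_prim k).[-1] = 0.
Proof.
rewrite !(hornerZ, hornerD, hornerN) !legendre_atN1 !exprS; ring.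
Qed.

Lemma radauN1 k : (radau k).[-1] = 1.
Proof.
rewrite !(hornerZ, hornerD, hornerN) !legendre_atN1 !exprS.
have := sqrr_sign R k; set s := (-1) ^+ k => s2; rewrite expr2 in s2.
transitivity (s * s); last exact: s2.
by field.
Qed.

Lemma radau1 k : (radau k).[1] = 0.
Proof. by rewrite !(hornerZ, hornerD, hornerN) !legendre_at1 subrr mulr0. Qed.

Lemma normr_radau_le1 k x : -1 <= x <= 1 -> `|(radau k).[x]| <= 1.
Proof.
move=> x1; rewrite hornerZ hornerD hornerN !normrM normrX normrN1 expr1n mul1r.
rewrite ger0_norm ?invr_ge0// mulrC ler_pdivrMr// mul1r (le_trans (ler_normB _ _))//.
by rewrite -[2]/(1 + 1) lerD// legendre_le1.
Qed.

Lemma size_radau_prim k : (size (radau_prim k) <= k.+4)%N.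
Proof.
have sL i : (i <= k.+3)%N -> (size (L i) <= k.+4)%N.
  by move=> ik; apply: leq_trans (size_legendre _) _.
have sB i j : (i <= k.+3)%N -> (j <= k.+3)%N -> (size (L i - L j)%R <= k.+4)%N.
  by move=> ik jk; rewrite (leq_trans (size_polyD _ _))// size_polyN geq_max !sL.
rewrite (leq_trans (size_scale_leq _ _))// (leq_trans (size_polyD _ _))//.
by rewrite size_polyN geq_max !(leq_trans (size_scale_leq _ _)) ?sB//;
  do ?[exact: leqnn | apply: leqW].
Qed.

Lemma radau_ortho k q : (size q <= k.+1)%N -> int1 (radau k * q) = 0.
Proof.
move=> sq; rewrite -scalerAl pintZ mulrBl pintB !legendre_ortho ?subrr ?mulr0//.
exact: leqW.
Qed.

Lemma radau_norm k :
  int1 (radau k * radau k) = 2 * (k%:R + 2) / ((2 * k%:R + 3) * (2 * k%:R + 5)).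
Proof.
rewrite pint_mulZZ pint_sqrB !legendre_norm.
rewrite legendre_orthogonal ?gtn_eqF// -[k.+2%:R]natr1 -[k.+1%:R]natr1.
have := sqrr_sign R k; set s := (-1) ^+ k => s2; rewrite expr2 in s2.
have k0 : 0 <= k%:R :> R by [].
set A := (X in s / 2 * (s / 2) * X).
rewrite [LHS](_ : _ = s * s * (A / 4)); last by field.
rewrite s2 mul1r /A; field; rewrite !lt0r_neq0//; lra.
Qed.

(** The four indices k, ..., k + 3 are distinct, so only the squared norms of
    the Legendre polynomials contribute. *)
Lemma radau_prim_norm k : int1 (radau_prim k * radau_prim k) =
  4 * (k%:R + 2) /
  ((2 * k%:R + 1) * (2 * k%:R + 3) * (2 * k%:R + 5) * (2 * k%:R + 7)).
Proof.
have ortho i j : (i < j)%N -> int1 (L j * L i) = 0.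
  by move=> ij; rewrite legendre_orthogonal// gtn_eqF.
have orthoD : int1 ((L k.+3 - L k.+1) * (L k.+2 - L k)) =
    - int1 (L k.+1 * L k.+2).
  have -> : (L k.+3 - L k.+1) * (L k.+2 - L k) =
    L k.+3 * L k.+2 - L k.+3 * L k - L k.+1 * L k.+2 + L k.+1 * L k by ring.
  rewrite pintD !pintB !(ortho k) ?(ortho k.+2 k.+3)//; first by ring.
  by do 2 apply: ltnW.
rewrite pint_mulZZ pint_sqrB !pint_mulZZ.
rewrite orthoD legendre_orthogonal ?ltn_eqF// !pint_sqrB !legendre_norm !ortho//.
rewrite -[k.+3%:R]natr1 -[k.+2%:R]natr1 -[k.+1%:R]natr1.
have := sqrr_sign R k; set s := (-1) ^+ k => s2; rewrite expr2 in s2.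
have k0 : 0 <= k%:R :> R by [].
set A := (X in s / 2 * (s / 2) * X).
rewrite [LHS](_ : _ = s * s * (A / 4)); last by field.
rewrite s2 mul1r /A; field; rewrite !lt0r_neq0//; lra.
Qed.

End Radau.

Section Profile.
Context {R : realType}.
Variables (a b : R) (k : nat).
Hypothesis ab : a < b.
Implicit Types (p q : {poly R}) (x y : R).

Let tau_gt0 : 0 < b - a. Proof. by rewrite subr_gt0. Qed.
Let tau_neq0 : b - a != 0. Proof. exact: lt0r_neq0. Qed.

(** The affine maps between [a, b] and [-1, 1]. *)
Definition to_ref : {poly R} := (2 / (b - a)) *: 'X + (- (a + b) / (b - a))%:P.
Definition of_ref : {poly R} := ((b - a) / 2) *: 'X + ((a + b) / 2)%:P.

Lemma of_refK : of_ref \Po to_ref = 'X.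
Proof.
rewrite comp_polyD comp_polyZ comp_polyX comp_polyC /to_ref scalerDr scalerA.
have -> : (b - a) / 2 * (2 / (b - a)) = 1 by field.
rewrite scale1r -addrA -mul_polyC -polyCM -polyCD.
have -> : (b - a) / 2 * (- (a + b) / (b - a)) + (a + b) / 2 = 0 by field.
by rewrite addr0.
Qed.

Lemma size_comp_affine p q : (size q <= 2)%N -> (size (p \Po q) <= size p)%N.
Proof.
have [->|p0] := eqVneq p 0; first by rewrite comp_poly0.
move=> sq; apply: leq_trans (size_comp_poly_leq _ _) _.
rewrite -[leqRHS]prednK ?size_poly_gt0// ltnS -[leqRHS]muln1 leq_mul//.
by case: (size q) sq.
Qed.

Lemma size_affine (c d : R) : (size (c *: 'X + d%:P)%R <= 2)%N.
Proof.
rewrite (leq_trans (size_polyD _ _))// geq_max.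
by rewrite (leq_trans (size_scale_leq _ _)) ?size_polyX// size_polyC; case: eqP.
Qed.

Lemma pint_to_ref p : pint a b (p \Po to_ref) = (b - a) / 2 * pint (-1) 1 p.
Proof.
have -> : pint (-1) 1 p = 2 / (b - a) * pint a b (p \Po to_ref).
  by rewrite pint_comp_affine; congr pint; field.
by field.
Qed.

Lemma to_ref_horner x : to_ref.[x] = (2 * x - a - b) / (b - a).
Proof. by rewrite /to_ref !(hornerD, hornerZ, hornerX, hornerC); field. Qed.

Lemma to_ref_itv x : a <= x <= b -> -1 <= to_ref.[x] <= 1.
Proof.
move=> /andP[ax xb]; rewrite to_ref_horner ler_pdivlMr// ler_pdivrMr//.
by apply/andP; split; lra.
Qed.

Lemma to_refa : to_ref.[a] = -1.
Proof. by rewrite to_ref_horner; field. Qed.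

Lemma to_refb : to_ref.[b] = 1.
Proof. by rewrite to_ref_horner; field. Qed.

Lemma size_comp_to_ref p : (size (p \Po to_ref) <= size p)%N.
Proof. exact/size_comp_affine/size_affine. Qed.

(** The factor is the inverse of the slope of [to_ref], which makes the
    derivative of [profile] at [a] equal to 1. *)
Definition profile : {poly R} := ((b - a) / 2) *: (radau_prim k \Po to_ref).

Lemma profile_deriv : profile^`() = radau k \Po to_ref.
Proof.
rewrite derivZ deriv_comp radau_prim_deriv.
rewrite {2}/to_ref derivD derivZ derivX derivC addr0 alg_polyC [_ * _%:P]mulrC mul_polyC.
rewrite scalerA.
have -> : (b - a) / 2 * (2 / (b - a)) = 1 by field.
by rewrite scale1r.
Qed.

Lemma size_profile : (size profile <= k.+4)%N.
Proof.
apply: leq_trans (size_scale_leq _ _) _.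
by rewrite (leq_trans (size_comp_to_ref _))// size_radau_prim.
Qed.

Lemma profile_a : profile.[a] = 0.
Proof. by rewrite hornerZ horner_comp to_refa radau_primN1 mulr0. Qed.

Lemma profile_deriv_a : profile^`().[a] = 1.
Proof. by rewrite profile_deriv horner_comp to_refa radauN1. Qed.

Lemma profile_deriv_b : profile^`().[b] = 0.
Proof. by rewrite profile_deriv horner_comp to_refb radau1. Qed.

Lemma normr_profile_deriv_le1 x : a <= x <= b -> `|profile^`().[x]| <= 1.
Proof.
by move=> /to_ref_itv x1; rewrite profile_deriv horner_comp normr_radau_le1.
Qed.

Lemma profile_deriv_norm : pint a b (profile^`() * profile^`()) =
  (b - a) * ((k%:R + 2) / ((2 * k%:R + 3) * (2 * k%:R + 5))).
Proof.
rewrite profile_deriv -comp_polyM pint_to_ref radau_norm.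
have k0 : 0 <= k%:R :> R by [].
by field; rewrite !lt0r_neq0//; lra.
Qed.

Lemma profile_norm : pint a b (profile * profile) =
  (b - a) ^+ 3 * ((k%:R + 2) / (2 *
  ((2 * k%:R + 1) * (2 * k%:R + 3) * (2 * k%:R + 5) * (2 * k%:R + 7)))).
Proof.
rewrite pint_mulZZ -comp_polyM pint_to_ref radau_prim_norm.
have k0 : 0 <= k%:R :> R by [].
by field; rewrite !lt0r_neq0//; lra.
Qed.

(** Minus the second derivative represents the evaluation at [a] on the
    polynomials of degree at most [k + 1]: integrating by parts leaves only the
    boundary term at [a], since the derivative of [profile] vanishes at [b] and
    is orthogonal to the derivative of [q]. *)
Lemma profile_second_deriv q : (size q <= k.+2)%N ->
  pint a b (profile^`()^`() * q) = - q.[a].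
Proof.
move=> sq; rewrite pint_parts !hornerM profile_deriv_a profile_deriv_b.
rewrite mul0r mul1r sub0r profile_deriv.
have -> : q^`() = (q^`() \Po of_ref) \Po to_ref.
  by rewrite -comp_polyA of_refK comp_polyXr.
rewrite -comp_polyM pint_to_ref radau_ortho ?mulr0 ?subr0//.
by rewrite (leq_trans (size_comp_affine _ (size_affine _ _)))// size_deriv_le.
Qed.

(** The second derivative of the difference is an admissible test function, so
    it is orthogonal to itself; the initial values do the rest. *)
Lemma profile_unique j p : (size p <= k.+4)%N -> p.[a] = 0 -> p^`().[a] = j ->
  (forall q, (size q <= k.+2)%N -> pint a b (p^`()^`() * q) = - j * q.[a]) ->
  p = j *: profile.
Proof.
move=> sp pa p'a p''; pose d := p - j *: profile.
suff d0 : d = 0 by apply/eqP; rewrite -subr_eq0; apply/eqP.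
have sd : (size d <= k.+4)%N.
  rewrite (leq_trans (size_polyD _ _))// geq_max sp size_polyN.
  by rewrite (leq_trans (size_scale_leq _ _))// size_profile.
have d'' : d^`()^`() = 0.
  apply: (pint_sqr_eq0 ab).
  have sd'' : (size d^`()^`() <= k.+2)%N by do 2 apply: size_deriv_le.
  have perp q : (size q <= k.+2)%N ->
      pint a b ((p^`()^`() - j *: profile^`()^`()) * q) = 0.
    move=> sq; rewrite mulrBl pintB -scalerAl pintZ p''//.
    by rewrite profile_second_deriv//; ring.
  by rewrite -(perp _ sd'') derivB derivZ derivB derivZ.
have d' : d^`() = 0.
  have da : d^`().[a] = 0.
    by rewrite derivB derivZ hornerD hornerN hornerZ profile_deriv_a p'a mulr1 subrr.
  apply: (poly_itv_eq0 ab) => x _; rewrite -da; exact: deriv_eq0_horner.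
have da : d.[a] = 0 by rewrite hornerD hornerN hornerZ profile_a pa mulr0 subrr.
by apply: (poly_itv_eq0 ab) => x _; rewrite -da; exact: deriv_eq0_horner.
Qed.

End Profile.

(** * Lebesgue integrals over half-open intervals *)

Section Integral.
Context {R : realType}.
Notation mu := (@lebesgue_measure R).
Implicit Types (p : {poly R}) (a b : R).

Lemma integral_horner a b p : a < b ->
  (\int[mu]_(x in `[a, b]) (p.[x])%:E = (pint a b p)%:E)%E.
Proof.
move=> ab; rewrite (@continuous_FTC2 _ _ (horner (antideriv p)))//.
- exact/continuous_subspaceT/continuous_horner.
- have c := @continuous_horner R (antideriv p).
  split.
  + by move=> x _; exact: derivable_horner.
  + exact/cvg_at_right_filter/c.
  + exact/cvg_at_left_filter/c.
- by move=> x _; rewrite -derive.derivE deriv_antideriv.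
Qed.

(** The equality is asked inside the interval only because a two-sided
    derivative at [b] also depends on the values beyond [b]. *)
Lemma integral_oc_poly a b p (f : R -> R) : a < b ->
  (forall x, a < x < b -> f x = p.[x]) ->
  (\int[mu]_(x in `]a, b]) (f x)%:E = (pint a b p)%:E)%E.
Proof.
move=> ab fp; rewrite -integral_horner//.
pose g : R -> R := horner p.
have mp : measurable_fun `]a, b[ (EFin \o g).
  apply/measurable_EFinP; exact: measurable_poly.
have fpE : {in (`]a, b[%classic : set R), EFin \o g =1 EFin \o f}.
  by move=> x; rewrite inE/= in_itv/= => xab; rewrite /g fp.
have mf := eq_measurable_fun _ fpE mp.
rewrite integral_itv_bndoo//= [RHS]integral_itv_bndoo//=.
by apply: eq_integral => x /fpE.
Qed.

Lemma ae_witness a b (P : set R) : a < b ->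
  (\forall x \ae mu, P x) -> exists2 x, a < x < b & P x.
Proof.
move=> ab [N [mN N0 PN]]; apply: contrapT => nP.
have sub : `]a, b[ `<=` N.
  by move=> x /=; rewrite in_itv/= => xab; apply: PN => Px; apply: nP; exists x.
have : (mu `]a, b[ <= mu N)%E by apply: le_measure; rewrite ?inE.
rewrite lebesgue_measure_itv/= lte_fin ab.
by rewrite [leRHS]N0 -EFinB lee_fin subr_le0 leNgt ab.
Qed.

End Integral.

(** * Vector-valued polynomials and their scalar projections *)

Section TimePoly.
Context {R : realType} {X : normedModType R}.
Implicit Types (a : nat -> X) (n k : nat) (s : R).

Definition teval n a s : X := \sum_(k < n) s ^+ k *: a k.

(** Coefficients of the derivative. *)
Definition tderiv a k : X := k.+1%:R *: a k.+1.

Lemma is_derive_scalel (g : R -> R) (dg s : R) (x : X) :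
  is_derive s 1 g dg -> is_derive s 1 (fun u => g u *: x) (dg *: x).
Proof.
move=> [dgs <-].
pose quot h : X := h^-1 *: (((fun u => g u *: x) \o shift s) (h *: 1) - g s *: x).
have c : quot @ 0^' --> 'D_1 g s *: x.
  have -> : quot = (fun h => (h^-1 *: ((g \o shift s) (h *: 1) - g s)) *: x).
    by apply/funext => h; rewrite /quot /= -scalerBl scalerA.
  exact: cvgZr_tmp.
by apply: DeriveDef; [apply/cvg_ex; eexists; exact: c|exact: cvg_lim c].
Qed.

Lemma is_derive_teval n a s : is_derive s 1 (teval n a) (teval n.-1 (tderiv a) s).
Proof.
have -> : teval n a = \sum_(k < n) (fun u => u ^+ k *: a k).
  by apply/funext => u; rewrite fct_sumE.
have -> : teval n.-1 (tderiv a) s = \sum_(k < n) ((k%:R * s ^+ k.-1) *: a k).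
  case: n => [|n]; first by rewrite /teval !big_ord0.
  rewrite big_ord_recl mul0r scale0r add0r; apply: eq_bigr => k _.
  by rewrite /tderiv scalerA mulrC.
apply: is_derive_sum => k; apply: is_derive_scalel.
have -> : (fun u : R => u ^+ k) = horner 'X^k by apply/funext => u; rewrite hornerXn.
apply: is_derive_eq.
by rewrite derivXn hornerMn hornerXn mulr_natl.
Qed.

Lemma derive1_teval n a : derive1 (teval n a) = teval n.-1 (tderiv a).
Proof.
by apply/funext => s; rewrite derive1E; apply: derive_val; exact: is_derive_teval.
Qed.

Lemma continuous_teval n a : continuous (teval n a).
Proof.
move=> s; apply/differentiable_continuous/derivable1_diffP.
by case: (is_derive_teval n a s).
Qed.

Lemma derive1_eq_oo (a b : R) (f g : R -> X) :
  (forall x, a < x < b -> f x = g x) ->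
  forall x, a < x < b -> derive1 f x = derive1 g x.
Proof.
move=> fg x xab; rewrite !derive1E; apply: near_eq_derive.
have : \forall y \near x, y \in `]a, b[ by apply: near_in_itvoo; rewrite in_itv.
by apply: filterS => y; rewrite in_itv/= => /fg.
Qed.

Variable ip : {dot X for idfun}.

(** The real polynomial s |-> <P(s), y>; knowing it for all y determines P, and
    it commutes with derivation ([dual_poly_deriv]). *)
Definition dual_poly n a (y : X) : {poly R} := \poly_(k < n) ip (a k) y.

Lemma ip_teval n a y s : ip (teval n a s) y = (dual_poly n a y).[s].
Proof.
rewrite linear_sumlz horner_poly; apply: eq_bigr => k _.
by rewrite linearZl_LR/= mulrC.
Qed.

Lemma dual_poly_deriv n a y :
  (dual_poly n a y)^`() = dual_poly n.-1 (tderiv a) y.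
Proof.
apply/polyP => i; rewrite coef_deriv !coef_poly.
case: n => [|n] /=; first by rewrite mul0rn.
by rewrite ltnS; case: ifP => _; rewrite ?mul0rn// linearZl_LR/= mulr_natl.
Qed.

End TimePoly.

(** * Norms of functions of size c |p| *)


Section Lp.
Context {R : realType} {X : normedModType R}.
Notation mu := (@lebesgue_measure R).
Implicit Types (p : {poly R}) (a b c : R) (f : R -> X).

Lemma Lp_norm2_poly a b p c f : a < b ->
  (forall x, a < x < b -> `|f x| = `|p.[x]| * c) ->
  (Lp_norm 2%:E `]a, b] f ^+ 2 = (pint a b (p * p) * c ^+ 2)%:E)%E.
Proof.
move=> ab fp.
rewrite (_ : _ ^+ 2 = Lp_norm 2%:E `]a, b] f `^ 2)%E; last first.
  have := Lnorm_ge0 mu 2%:E ((fun s => (`|f s|)%:E) \_ `]a, b]).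
  rewrite -/(Lp_norm _ _ _); case: (Lp_norm _ _ _) => [r||]//.
  - by rewrite lee_fin => r0; rewrite poweR_EFin (powR_mulrn 2)// EFin_expe.
  - by rewrite poweRyr// expe2 mulyy.
rewrite poweR_Lnorm//.
transitivity (\int[mu]_(x in `]a, b]) (`|f x| ^+ 2)%:E)%E.
  rewrite [RHS]integral_mkcond; apply: eq_integral => x _.
  rewrite !patchE; case: ifPn => _.
    by rewrite abse_EFin normr_id poweR_EFin (powR_mulrn 2).
  by rewrite abse0 poweR0r.
rewrite (@integral_oc_poly _ _ _ (c ^+ 2 *: (p * p)))// ?pintZ 1?mulrC//.
move=> x xab; rewrite fp// exprMn real_normK ?num_real// hornerZ hornerM expr2.
by rewrite mulrC.
Qed.

(** The bound c is attained only in the limit at [a], so it is approached on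
    the sets ]a, a + d[, which are not negligible. *)
Lemma Lp_normy_poly a b p c f : a < b -> 0 <= c ->
  (forall x, a < x < b -> `|p.[x]| <= 1) -> p.[a] = 1 ->
  (forall x, a < x < b -> `|f x| = `|p.[x]| * c) ->
  (Lp_norm +oo `]a, b] f = c%:E)%E.
Proof.
move=> ab c0 p1 pa fp.
rewrite /Lp_norm unlock /Lnorm ifT; last first.
  by have := @lebesgue_measure_itv R `]-oo, +oo[; rewrite set_itvNyy /= => ->; rewrite lt0y.
set F := _ \o _.
have Foo x : a < x < b -> F x = (`|p.[x]| * c)%:E.
  move=> xab; rewrite /F/= patchE mem_set/=; last first.
    by rewrite in_itv/=; case/andP: xab => -> /ltW ->.
  by rewrite normr_id fp.
apply/eqP; rewrite eq_le; apply/andP; split.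
  (* the only exceptional point is b, where f is arbitrary *)
  apply/ess_supP.
  exists [set b]; split => //; first exact: lebesgue_measure_set1.
  move=> x /= nx; apply: contrapT => xb; apply: nx.
  rewrite /F/= patchE; case: ifPn => [|_]; last by rewrite abse0 lee_fin.
  rewrite inE/= in_itv/= => /andP[ax xb'].
  have xab : a < x < b by rewrite ax lt_neqAle xb' andbT; apply/eqP.
  have := Foo x xab; rewrite /F/= patchE mem_set/= ?in_itv/= ?ax// => ->.
  by rewrite lee_fin ler_piMl// p1.
have := ess_sup_ge mu F; set M := ess_sup mu F => FM.
apply/lee_addgt0Pr => e e0.
have [d d0 dP] : exists2 d, 0 < d & forall x, a < x < a + d -> c - e <= `|p.[x]| * c.
  have : (fun x => p.[x] * c) x @[x --> a] --> p.[a] * c.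
    by apply: cvgM; [exact: continuous_horner|exact: cvg_cst].
  move/cvgrPdist_le => /(_ e e0)[d /= d0 dP]; exists d => // x /andP[ax xd].
  have /dP : ball a d x.
    by rewrite /ball/= distrC gtr0_norm ?subr_gt0// ltrBlDl.
  rewrite pa mul1r ler_distlC => /andP[le1 _].
  by rewrite (le_trans le1)// ler_wpM2r// ler_norm.
have abd : a < Num.min b (a + d) by rewrite lt_min ab ltrDl.
have [x /andP[ax xm] FxM] := ae_witness abd FM.
move: xm; rewrite lt_min => /andP[xb xd].
rewrite -leeBlDr// (le_trans _ FxM)// Foo ?ax// -EFinB lee_fin dP//.
by rewrite ax.
Qed.

End Lp.

(** * The error is the profile times the jump *)

Section ErrorShape.
Context {R : realType} {X : normedModType R}.
Variable ip : {dot X for idfun}.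
Implicit Types (p r : {poly R}) (a b : R) (f V W : R -> X).

Lemma time_polyP q f : time_poly q f <-> exists c, f = teval q.+1 c.
Proof.
split=> [[c fc]|[c ->]]; exists c => //; exact/funext.
Qed.

Lemma time_poly_horner q r (y : X) : (size r <= q.+1)%N ->
  time_poly q (fun s => r.[s] *: y).
Proof.
move=> sr; exists (fun k => r`_k *: y) => s.
rewrite (horner_coef_wide _ sr) scaler_suml; apply: eq_bigr => k _.
by rewrite scalerA mulrC.
Qed.

Lemma restr_polyP q (I : set R) f : poly_on q I f ->
  exists c, restr_poly q I f = teval q.+1 c /\
    forall s, I s -> f s = teval q.+1 c s.
Proof.
move=> [P qP fP].
have [/time_polyP[c PE] fc] := @getPex _ [set P | time_poly q P /\
  forall s, I s -> f s = P s] (ex_intro _ P (conj qP fP)).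
by exists c; split=> // s /fc; rewrite PE.
Qed.

(** Testing in a constant direction [y] turns the inner product into an integral
    of real polynomials. *)
Lemma L2_inner_second_derive a b n c f r y : a < b ->
  (forall s, a < s <= b -> f s = teval n c s) ->
  L2_inner ip `]a, b] (derive1n 2 f) (fun s => r.[s] *: y) =
  pint a b ((dual_poly ip n c y)^`()^`() * r).
Proof.
move=> ab fc.
have fc' s : a < s < b -> f s = teval n c s.
  by move=> /andP[as_ sb]; rewrite fc// as_ ltW.
rewrite /L2_inner /Rintegral.
rewrite (integral_oc_poly (p := (dual_poly ip n c y)^`()^`() * r))// => s sab.
rewrite /derive1n/= (derive1_eq_oo (derive1_eq_oo fc'))// !derive1_teval.
by rewrite linearZr_LR/= ip_teval !dual_poly_deriv hornerM mulrC.
Qed.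

Lemma dot_eq0 (x : X) : ip x x = 0 -> x = 0.
Proof.
move=> xx; apply/eqP; apply: contraT => x0.
by have := @neq0_dnorm_gt0 _ _ _ ip x x0; rewrite xx ltxx.
Qed.

(** For each direction [y], the polynomial <V - W, y> solves the problem of
    [profile_unique] with slope <J, y>. So the difference of the two sides is
    orthogonal to every vector, itself included. *)
Lemma error_eq_profile a b k V W cV cW J : a < b ->
  (forall s, a < s <= b -> V s = teval k.+3 cV s) ->
  (forall s, a < s <= b -> W s = teval k.+4 cW s) ->
  teval k.+3 cV a = teval k.+4 cW a ->
  derive1 (teval k.+3 cV) a - derive1 (teval k.+4 cW) a = J ->
  (forall q, time_poly k.+1 q ->
     L2_inner ip `]a, b] (derive1n 2 W) q =
     L2_inner ip `]a, b] (derive1n 2 V) q + ip J (q a)) ->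
  forall s, teval k.+3 cV s - teval k.+4 cW s = (profile a b k).[s] *: J.
Proof.
move=> ab VE WE VWa dVWa VWq s.
pose psi y := dual_poly ip k.+3 cV y - dual_poly ip k.+4 cW y.
have psiE y u : ip (teval k.+3 cV u - teval k.+4 cW u) y = (psi y).[u].
  by rewrite linearBl/= !ip_teval hornerD hornerN.
have psi_profile y : psi y = ip J y *: profile a b k.
  apply: profile_unique => //.
  - rewrite (leq_trans (size_polyD _ _))// geq_max size_polyN.
    by rewrite size_poly (leq_trans (size_poly _ _)).
  - by rewrite -psiE VWa subrr linear0l.
  - rewrite -dVWa linearBl/= !derive1_teval !ip_teval -!dual_poly_deriv.
    by rewrite derivB hornerD hornerN.
  - move=> q sq; have := VWq _ (time_poly_horner y sq).
    rewrite (L2_inner_second_derive _ _ _ VE)// (L2_inner_second_derive _ _ _ WE)//.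
    rewrite linearZr_LR/= => e.
    by rewrite !derivB mulrBl pintB e; ring.
apply/eqP; rewrite -subr_eq0; apply/eqP/dot_eq0; set d := _ - _.
rewrite {1}/d linearBl/= psiE psi_profile linearZl_LR/= hornerZ; ring.
Qed.

(** Both sides are the limit of [V] at [a] from the right. Here [f] is the
    polynomial that [V] coincides with on ]a, b]. *)
Lemma right_trace a b V f : a < b -> {within `[a, b], continuous V} ->
  continuous f -> (forall s, a < s <= b -> V s = f s) -> V a = f a.
Proof.
move=> ab /continuous_within_itvP -/(_ ab)[_ Va _] cf Vf.
have fa : f @ a^'+ --> f a by apply: cvg_at_right_filter; exact: cf.
have fV : \forall s \near a^'+, f s = V s.
  near=> s; apply/esym/Vf/andP; split.
  - by near: s; exact: nbhs_right_gt.
  - by near: s; exact: nbhs_right_le.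
have Vfa : V @ a^'+ --> f a := cvg_trans (near_eq_cvg fV) fa.
exact: (cvg_unique (@norm_hausdorff _ _) Va (Vfa _)).
Unshelve. all: by end_near. Qed.

End ErrorShape.

(** * The constants *)

Section Constants.
Context {R : realType}.
Implicit Types (x : R).

Lemma le_tan x : 0 <= x < pi / 2 -> x <= tan x.
Proof.
move=> /andP[x0 xpi].
have cos0 y : 0 <= y <= x -> cos y != 0.
  move=> /andP[y0 yx]; apply/lt0r_neq0/cos_gt0_pihalf/andP; split.
    by rewrite (lt_le_trans _ y0)// oppr_lt0 divr_gt0// pi_gt0.
  exact: le_lt_trans yx xpi.
have D y : 0 <= y <= x -> is_derive y 1 (fun z : R => tan z - z) (tan y ^+ 2).
  move=> /cos0 cy.
  have dt := is_derive_tan cy; rewrite cos2_tan2// in dt.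
  have -> : tan y ^+ 2 = 1 + tan y ^+ 2 - 1 by ring.
  exact: is_deriveB.
have Doo y : y \in `]0, x[ -> is_derive y 1 (fun z : R => tan z - z) (tan y ^+ 2).
  by rewrite in_itv/= => /andP[y0 yx]; apply: D; rewrite !ltW.
rewrite -subr_ge0.
have -> : 0 = (fun z : R => tan z - z) 0 by rewrite /= tan0 subrr.
apply: (@ger0_derive1_le_cc _ (fun z : R => tan z - z) 0 x);
  rewrite ?in_itv/= ?lexx ?x0//.
- by move=> y /Doo[].
- by move=> y /Doo dy; rewrite derive1E derive_val sqr_ge0.
- apply: derivable_within_continuous => y; rewrite in_itv/= => /D[]//.
Qed.

(** t = tan (pi / 8) satisfies t^2 + 2 t = 1 by the duplication formula at
    tan (pi / 4) = 1, so pi <= 8 t = 8 (sqrt 2 - 1), about 3.32. *)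
Lemma pi_sqr_le14 : (pi : R) ^+ 2 <= 14.
Proof.
pose t : R := tan (pi / 8).
have pi0 := @pi_gt0 R.
have t_ge : pi / 8 <= t by apply: le_tan; apply/andP; split; lra.
have c8 : cos (pi / 8 : R) != 0.
  by apply/lt0r_neq0/cos_gt0_pihalf/andP; split; lra.
have := tan_mulr2n c8; rewrite -/t.
have -> : pi / 8 *+ 2 = pi / 4 :> R by rewrite mulr2n; field.
rewrite tan_piquarter => tE.
have t1 : 1 - t ^+ 2 != 0.
  by apply/eqP => t1; move: tE; rewrite t1 invr0 mulr0 => /eqP; rewrite oner_eq0.
have {}tE : 2 * t = 1 - t ^+ 2.
  by move/eqP: tE; rewrite eq_sym (can2_eq (divfK t1) (mulfK t1)) mul1r mulr2n => /eqP <-; ring.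
nra.
Qed.

Lemma mul_quarter (P Q : R) : 1 / 4 * (P / Q) = P / (4 * Q).
Proof. by rewrite invfM; ring. Qed.

Lemma c1_sqr k :
  c1 k.+2 ^+ 2 = (k%:R + 2) / ((2 * k%:R + 3) * (2 * k%:R + 5)) :> R.
Proof.
have k0 : 0 <= k%:R :> R by [].
rewrite /c1 -addn2 natrD sqr_sqrtr; last first.
  by rewrite divr_ge0 ?mulr_ge0//; lra.
by congr (_ / (_ * _)); ring.
Qed.

(** The left-hand side is the exact squared norm of the profile of degree
    p = [k + 2], divided by the cube of the length. *)
Lemma c2_sqr_ge k : (k%:R + 2) / (2 *
    ((2 * k%:R + 1) * (2 * k%:R + 3) * (2 * k%:R + 5) * (2 * k%:R + 7)))
  <= c2 k.+2 ^+ 2 :> R.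
Proof.
have pi0 := @pi_gt0 R; have pi14 := pi_sqr_le14.
have k0 : 0 <= k%:R :> R by [].
rewrite /c2; case: k k0 => [|k] k0; rewrite sqr_sqrtr /=.
- have d0 : 0 < 15 * pi ^+ 2 :> R by rewrite mulr_gt0// exprn_gt0.
  by rewrite [leLHS](_ : _ = 1 / 105) ?ler_pdivlMr//; [lra|field].
- by rewrite divr_ge0// mulr_ge0// sqr_ge0.
- have {}k0 : 0 <= k%:R :> R by [].
  rewrite -[k.+3%:R]natr1 -[k.+2%:R]natr1 -[k.+1%:R]natr1.
  rewrite mul_quarter ler_pdivrMr ?mulr_gt0//; try lra.
  rewrite mulrAC ler_pdivlMr ?mulr_gt0//; try lra.
  nra.
- have {}k0 : 0 <= k%:R :> R by [].
  rewrite -[k.+3%:R]natr1 -[k.+2%:R]natr1 -[k.+1%:R]natr1.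
  by rewrite mulr_ge0 ?divr_ge0 ?mulr_ge0//; lra.
Qed.

(** Squaring turns the two equivalences into bounds on rational functions. *)
Lemma deg_equiv_sqrt (A B : nat -> R) (c C : R) : 0 < c -> 0 < C ->
  (forall p, 0 <= B p) ->
  (forall p, (2 <= p)%N -> c ^+ 2 * B p ^+ 2 <= A p <= C ^+ 2 * B p ^+ 2) ->
  deg_equiv (fun p => Num.sqrt (A p)) B.
Proof.
move=> c0 C0 B0 AB; exists c, C; split=> // p p2.
have /andP[lo hi] := AB p p2.
have cB : 0 <= c * B p by rewrite mulr_ge0// ltW.
have CB : 0 <= C * B p by rewrite mulr_ge0// ltW.
by rewrite -(ger0_norm cB) -(ger0_norm CB) -!sqrtr_sqr !ler_wsqrtr// exprMn.
Qed.

Lemma powR_sqr (x r : R) : (x `^ r) ^+ 2 = x `^ (r * 2).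
Proof. by rewrite powRrM powR_mulrn// powR_ge0. Qed.

Lemma deg_equiv_c1 : deg_equiv (@c1 R) (fun p => p%:R `^ (- (1 / 2))).
Proof.
apply: (@deg_equiv_sqrt _ _ (1 / 2) 1) => // p p2.
have p2' : 2 <= p%:R :> R by rewrite ler_nat.
rewrite powR_sqr (_ : - (1 / 2) * 2 = -1); last by field.
rewrite powR_inv1//.
apply/andP; split.
- rewrite ler_pdivlMr ?mulr_gt0//; try lra.
  rewrite mulrAC ler_pdivrMr; last lra.
  nra.
- rewrite expr1n mul1r ler_pdivrMr ?mulr_gt0//; try lra.
  rewrite mulrC ler_pdivlMr; last lra.
  nra.
Qed.

Lemma deg_equiv_c2 : deg_equiv (@c2 R) (fun p => p%:R `^ (- (3 / 2))).
Proof.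
apply: (@deg_equiv_sqrt _ _ (1 / 4) 1) => // p p2.
rewrite powR_sqr (_ : - (3 / 2) * 2 = -3%:R); last by field.
rewrite powRN powR_mulrn// expr1n.
case: eqP => [->|p_neq2].
  have pi_ge := @pi_ge2 R; have pi14 := pi_sqr_le14.
  have d0 : 0 < 15 * pi ^+ 2 :> R by rewrite mulr_gt0// exprn_gt0// pi_gt0.
  have pi4 : 4 <= pi ^+ 2 :> R by nra.
  by rewrite ler_pdivlMr// ler_pdivrMr//; apply/andP; split; lra.
have p3 : (3 <= p)%N by rewrite ltn_neqAle p2 andbT eq_sym; apply/eqP.
have [m ->] : exists m, p = (m + 3)%N by exists (p - 3)%N; rewrite subnK.
have m0 : 0 <= m%:R :> R by [].
rewrite natrD; set x : R := m%:R in m0 *.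
have x3 : 0 < (x + 3%:R) ^+ 3 by rewrite exprn_gt0// ltr_wpDl.
set D := _ * (2 * _ + 1).
have D0 : 0 < D by rewrite /D !mulr_gt0//; lra.
have D4 : 0 < 4 * D by rewrite mulr_gt0 ?D0.
rewrite mul_quarter; apply/andP; split.
- rewrite ler_pdivlMr// mulrAC ler_pdivrMr// /D.
  nra.
- rewrite ler_pdivrMr// mulrAC ler_pdivlMr// /D.
  nra.
Qed.

End Constants.

(** * The theorem *)

Lemma time_grid_le (R : realType) N (T : R) t m n :
  time_grid N T t -> (m <= n <= N)%N -> t m <= t n.
Proof.
move=> [_ _ _ tS] /andP[mn nN]; elim: n mn nN => [|n IH]; first by rewrite leqn0 => /eqP->.
rewrite leq_eqVlt => /predU1P[->//|mn] nN.
by rewrite (le_trans (IH mn (ltnW nN)))// ltW// tS.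
Qed.

Lemma derive1_hornerZ (R : realType) (X : normedModType R) (p : {poly R}) (J : X) a b
    (f : R -> X) : (forall s, a < s < b -> f s = p.[s] *: J) ->
  forall s, a < s < b -> derive1 f s = p^`().[s] *: J.
Proof.
move=> fp s sab; rewrite (derive1_eq_oo fp)// derive1E.
by apply: derive_val; apply: is_derive_scalel.
Qed.

Theorem lemma3p3 (R : realType) :
  (forall (X : completeNormedModType R) (ip : {dot X for idfun})
      (N : nat) (T : R) (t : nat -> R) (p : nat -> nat)
      (V Vhat : R -> X) (v0 : X),
    hilbert_norm ip ->
    time_grid N T t ->
    (forall n, (1 <= n <= N)%N -> (2 <= p n)%N) ->
    {within `[0, T], continuous V} ->
    (forall n, (1 <= n <= N)%N -> poly_on (p n) (time_itv t n) V) ->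
    (forall n, (1 <= n <= N)%N -> reconstruction_on t p V v0 ip n Vhat) ->
    forall n, (1 <= n <= N)%N ->
      let I := time_itv t n in
      let tau := time_step t n in
      let J := jump_dV t p V v0 n in
      let e : R -> X := V \- Vhat in
      [/\ (Lp_norm 2%:E I (derive1 e) ^+ 2
            = (tau * c1 (p n) ^+ 2 * `|J| ^+ 2)%:E)%E,
          (Lp_norm +oo I (derive1 e) ^+ 2 = (`|J| ^+ 2)%:E)%E
        & (Lp_norm 2%:E I e ^+ 2
            <= (tau ^+ 3 * c2 (p n) ^+ 2 * `|J| ^+ 2)%:E)%E])
  /\ deg_equiv (@c1 R) (fun p => p%:R `^ (- (1 / 2)))
  /\ deg_equiv (@c2 R) (fun p => p%:R `^ (- (3 / 2))).
Proof.
split; last by split; [exact: deg_equiv_c1|exact: deg_equiv_c2].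
move=> X ip N T t p V Vhat v0 _ grid p_ge2 cV polyV recV n nN I tau J e.
have [/andP[n_gt0 nN'] [_ t0 tN tS]] := (nN, grid).
pose a := t n.-1; pose b := t n.
have ab : a < b by rewrite /a /b -[in ltRHS](prednK n_gt0) tS// prednK.
have [k pk] : exists k, p n = k.+2.
  by case: (p n) (p_ge2 n nN) => [|[|k]]// _; exists k.
have [cV' [VE V_oc]] := restr_polyP (polyV n nN).
have [polyW recW Wa dWa] := recV n nN.
have [cW [WE W_oc]] := restr_polyP polyW.
rewrite pk in VE V_oc WE W_oc recW Wa dWa *.
have itvE s : a < s <= b -> I s by move=> sab; rewrite /I /time_itv/= in_itv.
have J_E : J = derive1 (teval k.+3 cV') a - derive1 (teval k.+4 cW) a.
  by rewrite /J /jump_dV -dWa -WE /dV_plus pk -VE.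
have VaWa : teval k.+3 cV' a = teval k.+4 cW a.
  rewrite -WE Wa; apply/esym; apply: (right_trace ab).
  - apply: continuous_subspaceW cV; apply: subset_itv; rewrite bnd_simp.
    + by rewrite -t0 (time_grid_le grid)//= (leq_trans (leq_pred _)).
    + by rewrite -tN (time_grid_le grid)// nN' leqnn.
  - exact: continuous_teval.
  - by move=> s /itvE /V_oc.
have eE s : a < s <= b -> e s = (profile a b k).[s] *: J.
  move=> sab; rewrite /e/= V_oc ?W_oc; [|exact: itvE..].
  by apply: (error_eq_profile (ip := ip) ab (V := V) (W := Vhat)).
have eE' s : a < s < b -> e s = (profile a b k).[s] *: J.
  by move=> /andP[as_ sb]; rewrite eE// as_ ltW.
have deE := derive1_hornerZ eE'.
split.
- rewrite (@Lp_norm2_poly _ _ a b (profile a b k)^`() `|J|)//.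
    by rewrite profile_deriv_norm// c1_sqr.
  by move=> s sab; rewrite deE// normrZ.
- rewrite (@Lp_normy_poly _ _ a b (profile a b k)^`() `|J|)//.
  + by move=> s /andP[as_ sb]; rewrite normr_profile_deriv_le1// !ltW.
  + exact: profile_deriv_a.
  + by move=> s sab; rewrite deE// normrZ.
- rewrite (@Lp_norm2_poly _ _ a b (profile a b k) `|J|)//.
    rewrite profile_norm// lee_fin ler_wpM2r ?sqr_ge0// ler_wpM2l ?c2_sqr_ge//.
    by rewrite exprn_ge0// subr_ge0 ltW.
  by move=> s sab; rewrite eE'// normrZ.
Qed.
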